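(* Let $X$ be a Banach lattice and let $(e_n)_{n\ge1}$ be a semi-normalized basic sequence in $X$ (i.e. $0<\inf_n\|e_n\|\le\sup_n\|e_n\|<\infty$), with closed linear span $E=[e_n]$ and biorthogonal functionals $e_n^*\in E^*$. For $x\in E$ let $\mathcal{G}_m(x)$ denote the $m$-th natural greedy sum of $x$ (defined in the context). The following are equivalent. (i) For all $x\in E$, $\mathcal{G}_m(x)\xrightarrow{u}x$ as $m\to\infty$. (ii) For all $x\in E$, $\mathcal{G}_m(x)\xrightarrow{o}x$ as $m\to\infty$. (iii) For all $x\in E$ there is $u\in X$ with $|\mathcal{G}_m(x)|\le u$ for all $m$. (iv) For all $x\in E$, the sequence $\big(\bigvee_{n=1}^m|\mathcal{G}_n(x)|\big)_{m\ge1}$ is norm bounded. (v) There exists $C\ge1$ such that for all $x\in E$ and $m\in\mathbb{N}$, $\big\|\bigvee_{n=1}^m|\mathcal{G}_n(x)|\big\|\le C\|x\|$.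
   Context: For $x\in E$, the natural greedy ordering is the injective map $\rho=\rho_x:\mathbb{N}\to\mathbb{N}$ such that $\{n: e_n^*(x)\ne0\}\subseteq\rho(\mathbb{N})$ and, whenever $j<k$, either $|e^*_{\rho(j)}(x)|>|e^*_{\rho(k)}(x)|$, or $|e^*_{\rho(j)}(x)|=|e^*_{\rho(k)}(x)|$ and $\rho(j)<\rho(k)$. The $m$-th natural greedy sum is $\mathcal{G}_m(x)=\sum_{n=1}^m e^*_{\rho(n)}(x)e_{\rho(n)}$. Convergences in $X$: $x_n\xrightarrow{u}x$ (uniform convergence) means there exist $e\in X_+$ and real numbers $\epsilon_k\downarrow0$ such that for every $k$ there is $n_k$ with $|x_n-x|\le\epsilon_k e$ for all $n\ge n_k$. $x_n\xrightarrow{o}x$ (order convergence) means there is a net $(y_\beta)$ in $X$ with $y_\beta\downarrow0$ (decreasing with infimum $0$) such that for every $\beta$ there is $n_\beta$ with $|x_n-x|\le y_\beta$ for all $n\ge n_\beta$. *)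

(* Defs.v *)
From HB Require Import structures.
From mathcomp Require Import all_boot all_order all_algebra.
From mathcomp Require Import all_classical all_reals all_analysis.
From Stdlib Require Import ClassicalEpsilon.
Set Implicit Arguments. Unset Strict Implicit. Unset Printing Implicit Defensive.
Import Order.TTheory GRing.Theory Num.Theory.
Local Open Scope ring_scope.
Local Open Scope classical_set_scope.

Section BanachLattice.
Variables (R : realType) (X : normedModType R).

(** A (real) Banach lattice: a complete normed space X together with a
    lattice join [jn] making X a vector lattice (join-semilattice laws,
    translation invariance, positive homogeneity), whose norm is a lattice
    norm: |x| <= |y| implies ||x|| <= ||y||.  Completeness is imposed by
    taking X : completeNormedModType in the theorem. *)
Definition lle (jn : X -> X -> X) (x y : X) : Prop := jn x y = y.
Definition labs (jn : X -> X -> X) (x : X) : X := jn x (- x).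

Definition is_banach_lattice (jn : X -> X -> X) : Prop :=
  (forall x y, jn x y = jn y x) /\
  (forall x y z, jn x (jn y z) = jn (jn x y) z) /\
  (forall x, jn x x = x) /\
  (forall x y z, jn (x + z) (y + z) = jn x y + z) /\
  (forall (a : R) x y, 0 <= a -> jn (a *: x) (a *: y) = a *: jn x y) /\
  (forall x y, lle jn (labs jn x) (labs jn y) -> `|x| <= `|y|).

Fixpoint jsup (jn : X -> X -> X) (f : nat -> X) (m : nat) : X :=
  match m with
  | 0 => f 0%N
  | k.+1 => jn (jsup jn f k) (f k.+1)
  end.

Definition lspan (e : nat -> X) : set X :=
  [set x | exists (N : nat) (c : nat -> R), x = \sum_(i < N) c i *: e i].
Definition cspan (e : nat -> X) : set X := closure (lspan e).

Definition expansion (e : nat -> X) (x : X) (a : nat -> R) : Prop :=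
  (fun N => \sum_(i < N) a i *: e i) @ \oo --> x.

Definition basic_seq (e : nat -> X) : Prop :=
  (forall n, e n != 0) /\
  (forall x, cspan e x ->
     exists a, expansion e x a /\ forall b, expansion e x b -> b = a).

Definition seminormalized (e : nat -> X) : Prop :=
  exists c C : R, 0 < c /\ forall n, c <= `|e n| <= C.

(** biorthogonal functionals: e_n^*(x) = n-th expansion coefficient of x *)
Definition coef (e : nat -> X) (x : X) : nat -> R :=
  epsilon (inhabits (fun _ => 0)) (expansion e x).

Definition natural_greedy_ordering (a : nat -> R) (rho : nat -> nat) : Prop :=
  injective rho /\
  (forall n, a n != 0 -> exists j, rho j = n) /\
  (forall j k, (j < k)%N ->
     `|a (rho j)| > `|a (rho k)| \/
     (`|a (rho j)| = `|a (rho k)| /\ (rho j < rho k)%N)).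

Definition greedy_rho (e : nat -> X) (x : X) : nat -> nat :=
  epsilon (inhabits id) (natural_greedy_ordering (coef e x)).

Definition greedy_sum (e : nat -> X) (x : X) (m : nat) : X :=
  \sum_(n < m) coef e x (greedy_rho e x n) *: e (greedy_rho e x n).

Definition u_cvg (jn : X -> X -> X) (s : nat -> X) (x : X) : Prop :=
  exists (w : X) (eps : nat -> R),
    lle jn 0 w /\
    (forall k, 0 < eps k) /\ nonincreasing_seq eps /\ eps @ \oo --> 0 /\
    (forall k, exists nk, forall n, (nk <= n)%N ->
       lle jn (labs jn (s n - x)) (eps k *: w)).

Definition o_cvg (jn : X -> X -> X) (s : nat -> X) (x : X) : Prop :=
  exists (I : Type) (r : I -> I -> Prop) (y : I -> X),
    (forall i, r i i) /\
    (forall i j k, r i j -> r j k -> r i k) /\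
    (forall i j, exists k, r i k /\ r j k) /\
    (forall i j, r i j -> lle jn (y j) (y i)) /\
    (forall i, lle jn 0 (y i)) /\
    (forall z, (forall i, lle jn z (y i)) -> lle jn z 0) /\
    (forall i, exists ni, forall n, (ni <= n)%N ->
       lle jn (labs jn (s n - x)) (y i)).

End BanachLattice.

(* Main.v *)
Require Import Defs.
From HB Require Import structures.
From mathcomp Require Import all_boot all_order all_algebra.
From mathcomp Require Import all_classical all_reals all_analysis.
From mathcomp Require Import ring lra.
From Stdlib Require ClassicalEpsilon.
Import Order.TTheory GRing.Theory Num.Theory.
Import numFieldNormedType.Exports.
Local Open Scope ring_scope.
Local Open Scope classical_set_scope.
Set Implicit Arguments. Unset Strict Implicit. Unset Printing Implicit Defensive.

(** A finite index set [A] is greedy for [x] when every index of [A] precedes,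
    in the natural greedy ordering, every index outside [A] whose coefficient
    is nonzero.  Two greedy sets of the same size differ only by indices with
    zero coefficient, so [G_{#|A|}(x)] is the projection of [x] on [A]; in
    particular deleting finitely many coefficients of [x] only drops terms
    from its greedy sums.

    (v) => (i): [G_m(x) - S_N(x)] is a greedy sum of [x - S_N(x)] for large [m],
    hence the greedy sums converge in norm.  As [G_{k+m}(x) - G_k(x)] is a
    greedy sum of [x - G_k(x)], the suprema over the blocks [k_j, k_{j+1}] of a
    fast converging subsequence are summable with weights [2^j], and their sum
    regulates the uniform convergence.

    (iv) => (v): if (v) fails, vectors of small norm supported arbitrarily far
    have huge maximal greedy sums, because the coefficient functionals are
    continuous (Baire category inside the closed span).  Adding such humps one
    after the other, each below the smallest nonzero coefficient of the
    previous ones, yields a vector violating (iv); both category arguments go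
    through the same nested closed set lemma. *)

(** * Norm limits and a Baire category argument *)

Section NormedSequences.
Variables (R : realType) (X : normedModType R).
Implicit Types (u : nat -> X) (l : X).

Lemma cvgn_distP u l : u @ \oo --> l <->
  forall eps : R, 0 < eps -> exists N, forall n, (N <= n)%N -> `|u n - l| <= eps.
Proof.
split=> [/cvgrPdist_le H eps /H [N _ HN]|H].
  by exists N => n /HN /=; rewrite distrC.
apply/cvgrPdist_le => eps /H [N HN]; exists N => // n /= /HN.
by rewrite distrC.
Qed.

Lemma eq_cvgn_lim u l l' : u @ \oo --> l -> u @ \oo --> l' -> l = l'.
Proof. by move=> h h'; rewrite -(cvg_lim _ h) ?(cvg_lim _ h'). Qed.

Lemma cvgn_le_norm u l l0 (M : R) : u @ \oo --> l ->
  (exists N, forall n, (N <= n)%N -> `|u n - l0| <= M) -> `|l - l0| <= M.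
Proof.
move=> /cvgn_distP ul [N HN]; apply/ler_addgt0Pr => eps /ul[N' HN'].
pose n := maxn N N'.
have h1 := HN n (leq_maxl _ _); have h2 := HN' n (leq_maxr _ _).
by rewrite [M + eps]addrC (le_trans (ler_distD (u n) _ _))// lerD// distrC.
Qed.

Lemma ler0_of_leeps (a : R) : (forall eps : R, 0 < eps -> a <= eps) -> a <= 0.
Proof. by move=> h; apply/ler_addgt0Pr => eps /h; rewrite add0r. Qed.

End NormedSequences.

Lemma cauchy_cvgn (R : realType) (X : completeNormedModType R) (u : nat -> X) :
  (forall eps : R, 0 < eps -> exists N, forall n, (N <= n)%N -> `|u n - u N| <= eps) ->
  exists l : X, u @ \oo --> l.
Proof.
move=> H; have : cauchy (u @ \oo).
  apply/cauchyP => eps eps0; have [|N HN] := H (eps / 2); first by lra.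
  exists (u N), N => // n /= /HN h; rewrite -ball_normE /= distrC.
  by rewrite (le_lt_trans h)// ltr_pdivrMr// ltr_pMr// ltr1n.
by move=> /cauchy_cvgP c; exists (lim (u @ \oo)).
Qed.

(** Each step shrinks the current set to one of diameter at most [1/(n+1)] that misses [K n], so
    points picked from the successive sets are Cauchy and their limit lies in all of them. The
    family [FF] is left abstract so that balls of the closed span and balls with frozen coordinates
    both fit. *)
Lemma nested_closed_sets (R : realType) (X : completeNormedModType R)
    (FF : set (set X)) (K : nat -> set X) (F0 : set X) :
  (forall F, FF F -> closed F /\ F !=set0) ->
  (forall F n, FF F -> exists F', [/\ FF F', F' `<=` F, F' `&` K n = set0 &
     forall x y, F' x -> F' y -> `|x - y| <= n.+1%:R^-1]) ->
  FF F0 -> exists2 x, F0 x & forall n, ~ K n x.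
Proof.
move=> cF step F00.
have [nxt Hnxt] : {f : set X * nat -> set X & forall p, FF p.1 ->
    [/\ FF (f p), f p `<=` p.1, f p `&` K p.2 = set0 &
     forall x y, f p x -> f p y -> `|x - y| <= p.2.+1%:R^-1]}.
  apply: (@choice (set X * nat) (set X) (fun p F' => FF p.1 ->
    [/\ FF F', F' `<=` p.1, F' `&` K p.2 = set0 &
     forall x y, F' x -> F' y -> `|x - y| <= p.2.+1%:R^-1])) => -[F n] /=.
  (* The value [F] outside [FF] only makes the choice function total; the iteration from [F0] stays
     in [FF]. *)
  have [FFF|nF] := pselect (FF F); last by exists F.
  by have [F' ?] := step F n FFF; exists F'.
pose Fs := fix Fs n := if n is n'.+1 then nxt (Fs n', n') else F0.
have FFs n : FF (Fs n) by elim: n => //= n IH; have [] := Hnxt (Fs n, n) IH.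
have FsS n : Fs n.+1 `<=` Fs n by have [] := Hnxt (Fs n, n) (FFs n).
have FsK n x : Fs n.+1 x -> ~ K n x.
  have [_ _ h _] := Hnxt (Fs n, n) (FFs n); move=> Fx Kx.
  by have : set0 x by rewrite -h; split.
have Fsd n x y : Fs n.+1 x -> Fs n.+1 y -> `|x - y| <= n.+1%:R^-1.
  by have [_ _ _] := Hnxt (Fs n, n) (FFs n); apply.
have FsM n m : (n <= m)%N -> Fs m `<=` Fs n.
  move=> /subnK <-; elim: (m - n)%N => // k IH x Fx.
  by apply: IH; apply: FsS; rewrite addSn in Fx.
have [x Hx] : {x : nat -> X & forall n, Fs n (x n)}.
  by apply: (@choice _ _ Fs) => n; have [_ [y ?]] := cF _ (FFs n); exists y.
have [l xl] : exists l : X, x @ \oo --> l.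
  apply: cauchy_cvgn => eps eps0.
  have [N HN] : exists N : nat, N.+1%:R^-1 <= eps.
    exists (Num.truncn eps^-1); rewrite invf_ple ?posrE// ltW//.
    by rewrite truncnS_gt// ?invr_ge0 ?ltW.
  exists N.+1 => n Nn; apply: le_trans HN.
  by apply: Fsd => //; apply: FsM (Hx n).
have Fl n : Fs n l.
  have [cl _] := cF _ (FFs n); apply: (closed_cvg _ cl _ _ xl).
  by exists n => // m /= nm; apply: FsM (Hx m).
by exists l => [|n]; [exact: (Fl 0%N)|apply: FsK (Fl n.+1)].
Qed.

(** * Vector lattice calculus and its interaction with the norm *)

Section Lattice.
Variables (R : realType) (X : completeNormedModType R) (jn : X -> X -> X).
Hypothesis BL : is_banach_lattice jn.
Implicit Types x y z w : X.

Local Notation "x <=| y" := (lle jn x y) (at level 70).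
Local Notation labs := (labs jn).

Lemma jnC x y : jn x y = jn y x. Proof. by case: BL => h _. Qed.
Lemma jnA x y z : jn x (jn y z) = jn (jn x y) z. Proof. by case: BL => _ [h _]. Qed.
Lemma jnn x : jn x x = x. Proof. by case: BL => _ [_ [h _]]. Qed.
Lemma jnDr x y z : jn (x + z) (y + z) = jn x y + z.
Proof. by case: BL => _ [_ [_ [h _]]]. Qed.
Lemma jnZ (a : R) x y : 0 <= a -> jn (a *: x) (a *: y) = a *: jn x y.
Proof. by case: BL => _ [_ [_ [_ [h _]]]]; exact: h. Qed.
Lemma le_norm_labs x y : labs x <=| labs y -> `|x| <= `|y|.
Proof. by case: BL => _ [_ [_ [_ [_ h]]]]; exact: h. Qed.

Lemma lle_refl x : x <=| x. Proof. exact: jnn. Qed.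
Lemma lle_trans x y z : x <=| y -> y <=| z -> x <=| z.
Proof. by rewrite /lle => xy yz; rewrite -yz jnA xy. Qed.
Lemma lle_anti x y : x <=| y -> y <=| x -> x = y.
Proof. by rewrite /lle => xy yx; rewrite -yx jnC xy. Qed.
Lemma jn_upl x y : x <=| jn x y. Proof. by rewrite /lle jnA jnn. Qed.
Lemma jn_upr x y : y <=| jn x y. Proof. by rewrite jnC; exact: jn_upl. Qed.
Lemma jn_lub x y z : x <=| z -> y <=| z -> jn x y <=| z.
Proof. by rewrite /lle => xz yz; rewrite -jnA yz. Qed.
Lemma lleDr z x y : x <=| y -> x + z <=| y + z.
Proof. by rewrite /lle jnDr => ->. Qed.
Lemma lleD x y z w : x <=| y -> z <=| w -> x + z <=| y + w.
Proof.
move=> xy zw; apply: (lle_trans (lleDr z xy)).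
by rewrite ![y + _]addrC; apply: lleDr.
Qed.
Lemma lleZ (a : R) x y : 0 <= a -> x <=| y -> a *: x <=| a *: y.
Proof. by rewrite /lle => a0 xy; rewrite jnZ // xy. Qed.
Lemma lleZl (a b : R) x : 0 <=| x -> a <= b -> a *: x <=| b *: x.
Proof.
rewrite -subr_ge0 => x0 ab; have := lleDr (a *: x) (lleZ ab x0).
by rewrite scaler0 add0r scalerBl subrK.
Qed.
Lemma lleN x y : x <=| y -> - y <=| - x.
Proof. by move=> /(lleDr (- x - y)); rewrite addrA subrr add0r [y + _]addrC subrK. Qed.

Lemma labs_ub x y : x <=| y -> - x <=| y -> labs x <=| y.
Proof. exact: jn_lub. Qed.
Lemma le_labs x : x <=| labs x. Proof. exact: jn_upl. Qed.
Lemma leN_labs x : - x <=| labs x. Proof. exact: jn_upr. Qed.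

(** Adding [x <= |x|] and [-x <= |x|] gives [0 <= |x| + |x|], and this can be halved. *)
Lemma labs_ge0 x : 0 <=| labs x.
Proof.
have h : 0 <=| labs x + labs x.
  by rewrite -(subrr x); apply: lleD; [exact: le_labs|exact: leN_labs].
have -> : labs x = 2^-1 *: (labs x + labs x).
  by rewrite scalerDr -scalerDl (_ : 2^-1 + 2^-1 = 1) ?scale1r//; lra.
by rewrite -(scaler0 _ (2^-1 : R)); apply: lleZ => //; rewrite invr_ge0 ler0n.
Qed.

Lemma labs_pos x : 0 <=| x -> labs x = x.
Proof.
move=> x0; rewrite /Defs.labs jnC; change (- x <=| x).
by apply: (lle_trans _ x0); rewrite -oppr0; exact: lleN.
Qed.

Lemma labsN x : labs (- x) = labs x.
Proof. by rewrite /Defs.labs opprK jnC. Qed.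

Lemma labs0 : labs 0 = 0. Proof. by apply: labs_pos; exact: lle_refl. Qed.

Lemma labsD x y : labs (x + y) <=| labs x + labs y.
Proof.
apply: labs_ub; rewrite ?opprD; apply: lleD;
  by [exact: le_labs|exact: leN_labs].
Qed.

Lemma labsB x y : labs (x - y) <=| labs x + labs y.
Proof. by rewrite -(labsN y); exact: labsD. Qed.

Lemma labsZ (a : R) x : 0 <= a -> labs (a *: x) = a *: labs x.
Proof. by move=> a0; rewrite /Defs.labs -scalerN jnZ. Qed.

Lemma labs_sum (I : Type) (r : seq I) (P : pred I) (f : I -> X) :
  labs (\sum_(i <- r | P i) f i) <=| \sum_(i <- r | P i) labs (f i).
Proof.
elim/big_rec2: _ => [|i y x _ h]; first by rewrite labs0; exact: lle_refl.
by apply: (lle_trans (labsD _ _)); apply: lleD => //; exact: lle_refl.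
Qed.

Lemma lle_sum (I : Type) (r : seq I) (P : pred I) (f g : I -> X) :
  (forall i, P i -> f i <=| g i) ->
  \sum_(i <- r | P i) f i <=| \sum_(i <- r | P i) g i.
Proof.
move=> fg; elim/big_rec2: _ => [|i y x Pi h]; first exact: lle_refl.
by apply: lleD => //; exact: fg.
Qed.

Lemma ladd_ge0 x y : 0 <=| x -> 0 <=| y -> 0 <=| x + y.
Proof. by move=> x0 y0; rewrite -[X in X <=| _]addr0; exact: lleD. Qed.

Lemma lsum_ge0 (I : Type) (r : seq I) (P : pred I) (f : I -> X) :
  (forall i, P i -> 0 <=| f i) -> 0 <=| \sum_(i <- r | P i) f i.
Proof. by move=> f0; elim/big_ind: _ => //; [exact: lle_refl|exact: ladd_ge0]. Qed.

Lemma norm_labs x : `|labs x| = `|x|.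
Proof.
have h : labs (labs x) = labs x by apply: labs_pos; exact: labs_ge0.
by apply/eqP; rewrite eq_le !le_norm_labs// h; exact: lle_refl.
Qed.

Lemma lle_norm x y : labs x <=| y -> `|x| <= `|y|.
Proof.
move=> xy; apply: le_norm_labs; rewrite (@labs_pos y)//.
by apply: lle_trans xy; exact: labs_ge0.
Qed.

Lemma lle_norm_pos x y : 0 <=| x -> x <=| y -> `|x| <= `|y|.
Proof. by move=> x0 xy; apply: lle_norm; rewrite labs_pos. Qed.

Lemma lle0_of_pos_part z : (forall eps : R, 0 < eps -> `|jn z 0| <= eps) -> z <=| 0.
Proof.
move=> /ler0_of_leeps; rewrite normr_le0 => /eqP h.
by rewrite -h; exact: jn_upl.
Qed.

(** The Archimedean property comes from the lattice norm: the positive part of [z] lies below every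
    [eps k *: w], whose norms tend to 0. *)
Lemma lle0_archimedean z w (eps : nat -> R) : eps @ \oo --> 0 ->
  (forall k, z <=| eps k *: w) -> (forall k, 0 <=| eps k *: w) -> z <=| 0.
Proof.
move=> /cvgn_distP eps0 H H0; apply: lle0_of_pos_part => d d0.
have w1 : 0 < `|w| + 1 by rewrite ltr_wpDl.
have [|N HN] := eps0 (d / (`|w| + 1)); first by rewrite divr_gt0.
have := HN N (leqnn _); rewrite subr0 => hN.
apply: (@le_trans _ _ `|eps N *: w|).
  by apply: lle_norm_pos; [exact: jn_upr|exact: jn_lub].
rewrite normrZ -(@ler_pM2r _ (`|w| + 1)^-1) ?invr_gt0//.
apply: le_trans hN; rewrite -mulrA ler_piMr// ler_pdivrMr// mul1r.
by rewrite lerDl.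
Qed.

(** The positive part of [s k - w] lies below [|s n - w|] for all [n >= k], so its norm is 0. *)
Lemma lle_cvg_incr (s : nat -> X) w k : s @ \oo --> w ->
  (forall n, (k <= n)%N -> s k <=| s n) -> s k <=| w.
Proof.
move=> /cvgn_distP sw H; suff h : s k - w <=| 0.
  by have := lleDr w h; rewrite subrK add0r.
apply: lle0_of_pos_part => d /sw[N HN].
apply: le_trans (HN (maxn N k) (leq_maxl _ _)).
rewrite -norm_labs -[X in _ <= X]norm_labs.
apply: lle_norm_pos; first exact: labs_ge0.
rewrite labs_pos; last exact: jn_upr.
apply: jn_lub; last exact: labs_ge0.
apply: lle_trans (le_labs _); apply: lleDr; apply: H; exact: leq_maxr.
Qed.

Lemma jsup_ub (f : nat -> X) n m : (n <= m)%N -> f n <=| jsup jn f m.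
Proof.
elim: m => [|m IH]; first by rewrite leqn0 => /eqP ->; exact: lle_refl.
rewrite leq_eqVlt => /orP[/eqP ->|]; first exact: jn_upr.
by rewrite ltnS => /IH h; apply: (lle_trans h); exact: jn_upl.
Qed.

Lemma jsup_lub (f : nat -> X) m w : (forall n, (n <= m)%N -> f n <=| w) ->
  jsup jn f m <=| w.
Proof.
elim: m => [|m IH] H; first exact: H.
by apply: jn_lub; [apply: IH => n nm; apply: H; exact: leqW|exact: H].
Qed.

Lemma eq_jsup (f g : nat -> X) m : f =1 g -> jsup jn f m = jsup jn g m.
Proof. by move=> fg; elim: m => //= m ->; rewrite fg. Qed.

Lemma jsupZ (a : R) (f : nat -> X) m : 0 <= a ->
  jsup jn (fun n => a *: f n) m = a *: jsup jn f m.
Proof. by move=> a0; elim: m => //= m ->; rewrite jnZ. Qed.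

End Lattice.

(** * Uniform convergence, order convergence and order boundedness *)

Section LatticeConvergence.
Variables (R : realType) (X : completeNormedModType R) (jn : X -> X -> X).
Hypothesis BL : is_banach_lattice jn.

(** The sequence [eps k *: w] is itself the required net: it decreases, and its infimum is 0 by the
    Archimedean property. *)
Lemma u_cvg_o_cvg (s : nat -> X) (x : X) : u_cvg jn s x -> o_cvg jn s x.
Proof.
move=> [w [eps [w0 [eps0 [epsd [epsc H]]]]]].
have epsw k : lle jn 0 (eps k *: w).
  by rewrite -(scaler0 _ (eps k)); apply: lleZ => //; exact: ltW.
exists nat, (fun i j => (i <= j)%N), (fun k => eps k *: w).
split; first by [].
split; first by move=> i j k; exact: leq_trans.
split; first by move=> i j; exists (maxn i j); rewrite leq_maxl leq_maxr.
split; first by move=> i j ij; apply: (lleZl BL w0); exact: epsd.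
by split=> //; split=> // z Hz; exact: (lle0_archimedean BL epsc Hz).
Qed.

(** A single net element bounds a whole tail by [y i + |x|]; the sum of the finitely many earlier
    moduli takes care of the rest. *)
Lemma o_cvg_bounded (s : nat -> X) (x : X) : (exists y : X, y != 0) ->
  o_cvg jn s x -> exists u, forall m, lle jn (labs jn (s m)) u.
Proof.
move=> [v v0] [I [r [y [_ [_ [_ [_ [y0 [yinf H]]]]]]]]].
(* Over an empty index type every vector would be a lower bound of the net, hence below 0; applied
   to [v] and [- v] this forces [v = 0]. *)
have [i _] : exists i : I, True.
  apply: contrapT => no.
  have le0 z : lle jn z 0 by apply: yinf => i; case: no; exists i.
  case/eqP: v0; apply: (lle_anti BL (le0 v)).
  by have := lleN BL (le0 (- v)); rewrite oppr0 opprK.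
have [N HN] := H i.
have tot_ge0 : lle jn 0 (\sum_(n < N) labs jn (s n)).
  by apply: lsum_ge0 => // n _; exact: labs_ge0.
exists (\sum_(n < N) labs jn (s n) + (y i + labs jn x)) => m.
have [mN|Nm] := ltnP m N.
  rewrite (bigD1 (Ordinal mN)) //= -addrA -{1}[labs jn (s m)]addr0.
  apply: (lleD BL); first exact: lle_refl.
  apply: ladd_ge0 => //; first by apply: lsum_ge0 => // n _; exact: labs_ge0.
  by apply: ladd_ge0 => //; exact: labs_ge0.
rewrite -[labs jn (s m)]add0r; apply: (lleD BL) => //.
rewrite -{1}(subrK x (s m)); apply: (lle_trans BL (labsD BL _ _)).
by apply: (lleD BL); [exact: HN|exact: lle_refl].
Qed.

End LatticeConvergence.

(** * Existence of the natural greedy ordering for a null sequence *)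

Section GreedyOrder.
Variables (R : realType) (a : nat -> R).
Implicit Types (i j k n : nat) (s : seq nat).

(** Strict precedence in the natural greedy ordering, as a relation between indices. *)
Definition beats i j : Prop :=
  `|a j| < `|a i| \/ (`|a i| = `|a j| /\ (i < j)%N).

Lemma beats_ge i j : beats i j -> `|a j| <= `|a i|.
Proof. by case=> [/ltW//|[-> _]]. Qed.

Lemma beats_trans i j k : beats i j -> beats j k -> beats i k.
Proof.
move=> [ij|[ij lij]] [jk|[jk ljk]]; first by left; exact: lt_trans jk ij.
- by left; rewrite -jk.
- by left; rewrite ij.
- by right; rewrite ij jk; split=> //; apply: ltn_trans ljk.
Qed.

Lemma beats_asym i j : beats i j -> ~ beats j i.
Proof.
move=> [ij|[ij lij]] [ji|[ji lji]].
- by have := lt_trans ij ji; rewrite ltxx.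
- by rewrite ji ltxx in ij.
- by rewrite ij ltxx in ji.
- by have := ltn_trans lij lji; rewrite ltnn.
Qed.

Lemma beats_total i j : i != j -> beats i j \/ beats j i.
Proof.
move=> ij; rewrite /beats.
case: (ltgtP `|a i| `|a j|) => h; [by right; left|by left; left|].
by case: (ltngtP i j) ij => // lij _; [left|right]; right.
Qed.

Lemma exists_best_below (P : pred nat) N : (exists2 i, (i < N)%N & P i) ->
  exists i, [/\ (i < N)%N, P i &
    forall j, (j < N)%N -> P j -> j != i -> beats i j].
Proof.
elim: N => [[]//|N IH] [i0 i0N Pi0].
have [/IH[i [iN Pi Hi]]|no] := pselect (exists2 i, (i < N)%N & P i); last first.
  have i0E : i0 = N.
    by move: i0N; rewrite ltnS leq_eqVlt => /orP[/eqP//|h]; case: no; exists i0.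
  exists i0; split=> // j; rewrite ltnS leq_eqVlt => /orP[/eqP->|jN Pj _].
    by rewrite i0E eqxx.
  by case: no; exists j.
have [PN|nPN] := boolP (P N); last first.
  exists i; split=> //; first exact: leqW.
  move=> j; rewrite ltnS leq_eqVlt => /orP[/eqP->|]; first by rewrite (negbTE nPN).
  exact: Hi.
have [|biN|bNi] := @beats_total i N; first by rewrite ltn_eqF.
  exists i; split=> //; first exact: leqW.
  by move=> j; rewrite ltnS leq_eqVlt => /orP[/eqP->//|]; exact: Hi.
exists N; split=> // j; rewrite ltnS leq_eqVlt => /orP[/eqP->|jN Pj _].
  by rewrite eqxx.
have [->//|ji] := eqVneq j i.
by apply: beats_trans bNi _; exact: Hi.
Qed.

Hypothesis a0 : a @ \oo --> 0.

Lemma small_coefs (d : R) : 0 < d -> exists N, forall n, (N <= n)%N -> `|a n| < d.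
Proof.
move=> d0; have [|N HN] := (cvgn_distP (X := R^o) a 0).1 a0 (d / 2); first by rewrite divr_gt0.
exists N => n /HN; rewrite subr0 => h; apply: (le_lt_trans h).
by rewrite ltr_pdivrMr// ltr_pMr// ltr1n.
Qed.

(** As the coefficients tend to 0, some candidate outside [s] beats every index outside [s] past a
    bound [N], which leaves a finite search. *)
Lemma exists_best_outside s :
  exists i, i \notin s /\ forall j, j \notin s -> j != i -> beats i j.
Proof.
suff [N [i0 i0N [si0 H]]] : exists N, exists2 i0, (i0 < N)%N & i0 \notin s /\
    forall j, (N <= j)%N -> j \notin s -> beats i0 j.
  have [|i [iN si Hi]] := @exists_best_below (fun i => i \notin s) N.
    by exists i0.
  exists i; split=> // j sj ji; case: (ltnP j N) => jN; first exact: Hi.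
  have [e|ne] := eqVneq i0 i; first by rewrite -e; exact: H.
  by apply: beats_trans (H _ jN sj); exact: Hi.
have [[i0 si0 ai0]|no] := pselect (exists2 i, i \notin s & a i != 0).
  have [|N HN] := @small_coefs `|a i0|; first by rewrite normr_gt0.
  exists N, i0; first by rewrite ltnNge; apply/negP => /HN; rewrite ltxx.
  by split=> // j /HN; left.
have z j : j \notin s -> a j = 0.
  by move=> sj; apply/eqP/negP => /negP aj; apply: no; exists j.
(* All coefficients outside [s] vanish here, so an index above the maximum of [s] precedes every
   later one by the tie rule. *)
pose i0 := (\max_(i <- s) i).+1.
have si0 : i0 \notin s.
  by apply/negP => si0; have := @leq_bigmax_seq _ s xpredT id i0 si0 isT; rewrite ltnn.
by exists i0.+1, i0 => //; split=> // j ij sj; right; rewrite !z.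
Qed.

(** The ordering is built by repeatedly choosing the best index not chosen yet; [rs n] lists the
    first [n] choices. *)
Lemma exists_natural_greedy_ordering : exists rho, natural_greedy_ordering a rho.
Proof.
have [nxt Hn] := choice exists_best_outside.
pose rs := fix rs n := if n is n'.+1 then rcons (rs n') (nxt (rs n')) else [::].
pose rho n := nxt (rs n).
have rsE j n : (j < n)%N -> rho j \in rs n.
  elim: n => // n IH; rewrite ltnS leq_eqVlt /= mem_rcons inE => /orP[/eqP->|/IH->].
    by rewrite eqxx.
  by rewrite orbT.
have rsM m n : (m <= n)%N -> {subset rs m <= rs n}.
  move=> /subnK <-; elim: (n - m)%N => // k IH r /IH h.
  by rewrite addSn /= mem_rcons inE h orbT.
have rsN n m : (m <= n)%N -> rho n \notin rs m.
  by move=> mn; have [+ _] := Hn (rs n); apply: contra; exact: rsM.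
have rho_inj : injective rho.
  move=> i j ij; apply/eqP; case: (ltngtP i j) => // h.
    by have := rsE _ _ h; rewrite ij (negbTE (rsN j j _)).
  by have := rsE _ _ h; rewrite -ij (negbTE (rsN i i _)).
have rho_beats j k : (j < k)%N -> beats (rho j) (rho k).
  move=> jk; have [_] := Hn (rs j); apply; first by apply: rsN; exact: ltnW.
  by apply/eqP => /rho_inj e; rewrite e ltnn in jk.
exists rho; split=> //; split=> // n an; apply: contrapT => no.
have bn j : beats (rho j) n.
  have [_] := Hn (rs j); apply; last by apply/eqP => e; apply: no; exists j.
  apply/negP => nj; apply: no; elim: j nj => // j IH /=.
  by rewrite mem_rcons inE => /orP[/eqP->|/IH//]; exists j.
(* A never chosen [n] is beaten by every [rho j]. Coefficients past [N] are smaller than [|a n|], so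
   all [rho j] lie below [N], contradicting injectivity on [N + 1] arguments. *)
have [|N HN] := @small_coefs `|a n|; first by rewrite normr_gt0.
have lt j : (rho j < N)%N.
  by rewrite ltnNge; apply/negP => /HN; rewrite ltNge beats_ge.
have : (size (map rho (iota 0 N.+1)) <= size (iota 0 N))%N.
  apply: uniq_leq_size; first by rewrite map_inj_uniq// iota_uniq.
  by move=> _ /mapP[j _ ->]; rewrite mem_iota add0n lt.
by rewrite size_map !size_iota ltnn.
Qed.

End GreedyOrder.

(** * Greedy sets: a description of greedy sums independent of the chosen ordering *)

Section GreedySets.
Variables (R : realType) (X : lmodType R).
Implicit Types (a : nat -> R) (A B : seq nat).

Definition greedy_set a A : Prop :=
  uniq A /\ forall i j, i \in A -> j \notin A -> a j != 0 -> beats a i j.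

(** Equal sizes give some [j] in [B] but not in [A]. If [a i] were nonzero, [j] would beat [i], so
    [a j] would be nonzero too and [i] would beat [j]. *)
Lemma greedy_set_diff0 a A B i : greedy_set a A -> greedy_set a B ->
  size A = size B -> i \in A -> i \notin B -> a i = 0.
Proof.
move=> [uA gA] [uB gB] sAB iA iB; apply/eqP/negP => /negP ai.
have [j jB jA] : exists2 j, j \in B & j \notin A.
  have [/allP sub|/allPn[j jB jA]] := boolP (all [in A] B); last by exists j.
  have [|_ eBA] := uniq_min_size uB sub; first by rewrite sAB.
  by move: iB; rewrite eBA iA.
have bji := gB _ _ jB iB ai.
have [aj0|aj] := eqVneq (a j) 0.
  by move: (beats_ge bji); rewrite aj0 normr0 normr_le0 (negbTE ai).
exact: beats_asym bji (gA _ _ iA jA aj).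
Qed.

(** Both sums reduce to the sum over the common indices. *)
Lemma greedy_set_sum a A B (v : nat -> X) : greedy_set a A -> greedy_set a B ->
  size A = size B -> \sum_(i <- A) a i *: v i = \sum_(i <- B) a i *: v i.
Proof.
move=> gA gB sAB.
have trunc C D : greedy_set a C -> greedy_set a D -> size C = size D ->
    \sum_(i <- C) a i *: v i = \sum_(i <- [seq i <- C | i \in D]) a i *: v i.
  move=> gC gD sCD; rewrite big_filter (bigID (fun i => i \in D)) /=.
  rewrite [X in _ + X]big_seq_cond [X in _ + X]big1 ?addr0// => i /andP[iC iD].
  by rewrite (greedy_set_diff0 gC gD sCD iC iD) scale0r.
rewrite (trunc _ _ gA gB)// (trunc _ _ gB gA)//; apply: perm_big.
apply: uniq_perm; rewrite ?filter_uniq ?(proj1 gA) ?(proj1 gB)// => i.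
by rewrite !mem_filter andbC.
Qed.

Lemma greedy_set_restrict a a' (P : pred nat) A : greedy_set a A ->
  (forall i, a' i = if P i then a i else 0) -> greedy_set a' [seq i <- A | P i].
Proof.
move=> [uA gA] a'E; split=> [|i j]; first by rewrite filter_uniq.
rewrite !mem_filter /beats !a'E => /andP[-> iA]; case: (P j) => /=; last by rewrite eqxx.
exact: gA.
Qed.

Lemma greedy_set_scale a (t : R) A : t != 0 -> greedy_set a A ->
  greedy_set (fun i => t * a i) A.
Proof.
move=> t0 [uA gA]; split=> // i j iA jA; rewrite mulf_eq0 negb_or t0 /= => /(gA _ _ iA jA).
rewrite /beats !normrM; case=> [h|[-> ?]]; [left|by right].
by rewrite ltr_pM2l ?normr_gt0.
Qed.

End GreedySets.

(** * Coefficients, partial sums and greedy sums in the closed span *)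

Section BasicSequence.
Variables (R : realType) (X : completeNormedModType R) (e : nat -> X).
Hypotheses (SN : seminormalized e) (BS : basic_seq e).
Implicit Types (x y : X) (A : seq nat).

Local Notation E := (cspan e).
Local Notation coef := (coef e).

Definition psum N x : X := \sum_(i < N) coef x i *: e i.

Lemma expansion_cspan x a : expansion e x a -> E x.
Proof.
move=> xa; apply: (closed_cvg _ (@closed_closure _ (lspan e)) _ _ xa).
by apply: nearW => N; apply: subset_closure; exists N, a.
Qed.

Lemma expansion_coef x : E x -> expansion e x (coef x).
Proof.
move=> /BS.2[a [xa _]]; apply: ClassicalEpsilon.epsilon_spec; by exists a.
Qed.

(** Uniqueness turns any exhibited expansion into the coefficients; linearity of [coef] is obtained
    this way. *)
Lemma coef_unique x a : expansion e x a -> coef x = a.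
Proof.
move=> xa; have Ex := expansion_cspan xa.
have [b [_ ub]] := BS.2 _ Ex.
by rewrite (ub _ xa); apply: ub; exact: expansion_coef.
Qed.

Lemma expansionD x y a b : expansion e x a -> expansion e y b ->
  expansion e (x + y) (fun i => a i + b i).
Proof.
move=> xa yb; rewrite /expansion.
rewrite (_ : (fun N => _) = (fun N => \sum_(i < N) a i *: e i) \+
                            (fun N => \sum_(i < N) b i *: e i)); first exact: cvgD.
by apply/funext => N /=; rewrite -big_split; apply: eq_bigr => i _; rewrite scalerDl.
Qed.

Lemma expansionZ (t : R) x a : expansion e x a ->
  expansion e (t *: x) (fun i => t * a i).
Proof.
move=> xa; rewrite /expansion.
rewrite (_ : (fun N => _) = t \*: (fun N => \sum_(i < N) a i *: e i)); first exact: cvgZl_tmp.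
by apply/funext => N /=; rewrite scaler_sumr; apply: eq_bigr => i _; rewrite scalerA.
Qed.

Lemma expansion_basis n : expansion e (e n) (fun i => (i == n)%:R).
Proof.
apply/cvgn_distP => d d0; exists n.+1 => N nN.
rewrite (bigD1 (Ordinal nN)) //= eqxx scale1r big1 ?addr0 ?subrr ?normr0 ?ltW// => i.
by rewrite -val_eqE /= => /negbTE ->; rewrite scale0r.
Qed.

Lemma cspanD x y : E x -> E y -> E (x + y).
Proof.
by move=> /expansion_coef hx /expansion_coef hy; exact: (expansion_cspan (expansionD hx hy)).
Qed.

Lemma cspanZ (t : R) x : E x -> E (t *: x).
Proof. by move=> /expansion_coef hx; exact: (expansion_cspan (expansionZ (t := t) hx)). Qed.

Lemma cspanN x : E x -> E (- x).
Proof. by rewrite -scaleN1r; exact: cspanZ. Qed.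

Lemma cspanB x y : E x -> E y -> E (x - y).
Proof. by move=> hx hy; apply: cspanD => //; exact: cspanN. Qed.

Lemma cspan_basis n : E (e n).
Proof. exact: (expansion_cspan (expansion_basis (n := n))). Qed.

Lemma cspan0 : E 0.
Proof. by rewrite -(subrr (e 0%N)); apply: cspanB; exact: cspan_basis. Qed.

Lemma cspan_sum A (c : nat -> R) : E (\sum_(i <- A) c i *: e i).
Proof.
elim/big_ind: _ => [||i _]; [exact: cspan0|exact: cspanD|].
by apply: cspanZ; exact: cspan_basis.
Qed.

Lemma coefD x y i : E x -> E y -> coef (x + y) i = coef x i + coef y i.
Proof.
by move=> hx hy; rewrite (coef_unique (expansionD (expansion_coef hx) (expansion_coef hy))).
Qed.

Lemma coefZ (t : R) x i : E x -> coef (t *: x) i = t * coef x i.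
Proof. by move=> hx; rewrite (coef_unique (expansionZ (t := t) (expansion_coef hx))). Qed.

Lemma coefN x i : E x -> coef (- x) i = - coef x i.
Proof. by move=> hx; rewrite -scaleN1r coefZ// mulN1r. Qed.

Lemma coefB x y i : E x -> E y -> coef (x - y) i = coef x i - coef y i.
Proof. by move=> hx hy; rewrite coefD ?coefN//; exact: cspanN. Qed.

Lemma coef0 i : coef 0 i = 0.
Proof. by rewrite -(scale0r 0) coefZ ?mul0r//; exact: cspan0. Qed.

Lemma coef_sum A (c : nat -> R) j : uniq A ->
  coef (\sum_(i <- A) c i *: e i) j = if j \in A then c j else 0.
Proof.
elim: A => [_|i A IH /=/andP[iA uA]]; first by rewrite big_nil coef0.
rewrite big_cons coefD; [|by apply: cspanZ; exact: cspan_basis|exact: cspan_sum].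
rewrite coefZ; last exact: cspan_basis.
rewrite (coef_unique (expansion_basis (n := i))) IH// inE.
have [->|ji] := eqVneq j i; first by rewrite (negbTE iA) mulr1 addr0.
by rewrite mulr0 add0r.
Qed.

Lemma psumE N x : psum N x = \sum_(i <- iota 0 N) coef x i *: e i.
Proof. by rewrite /psum -(big_mkord xpredT (fun i => coef x i *: e i)) /index_iota subn0. Qed.

Lemma cspan_psum N x : E (psum N x).
Proof. by rewrite psumE; exact: cspan_sum. Qed.

Lemma coef_psum N x j : coef (psum N x) j = if (j < N)%N then coef x j else 0.
Proof. by rewrite psumE coef_sum ?iota_uniq// mem_iota. Qed.

Lemma psumD N x y : E x -> E y -> psum N (x + y) = psum N x + psum N y.
Proof.
by move=> hx hy; rewrite /psum -big_split; apply: eq_bigr => i _; rewrite coefD// scalerDl.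
Qed.

Lemma psumZ N (t : R) x : E x -> psum N (t *: x) = t *: psum N x.
Proof.
by move=> hx; rewrite /psum scaler_sumr; apply: eq_bigr => i _; rewrite coefZ// scalerA.
Qed.

Lemma psumB N x y : E x -> E y -> psum N (x - y) = psum N x - psum N y.
Proof.
move=> hx hy; rewrite psumD; [|exact: hx|exact: cspanN].
by rewrite -scaleN1r psumZ; [rewrite scaleN1r|exact: hy].
Qed.

Lemma psum_cvg x : E x -> psum ^~ x @ \oo --> x.
Proof. exact: expansion_coef. Qed.

Lemma psum_finite N x : E x -> (forall i, (N <= i)%N -> coef x i = 0) -> psum N x = x.
Proof.
move=> Ex zx; apply: (eq_cvgn_lim (u := psum ^~ x)); last exact: psum_cvg.
apply/cvgn_distP => d d0; exists N => n Nn; rewrite (_ : psum n x = psum N x).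
  by rewrite subrr normr0 ltW.
rewrite /psum -!(big_mkord xpredT (fun i => coef x i *: e i)).
rewrite (big_cat_nat _ Nn) //= [X in _ + X]big_nat [X in _ + X]big1 ?addr0// => i /andP[Ni _].
by rewrite zx ?scale0r.
Qed.

Lemma coef_psumB n x : coef x n *: e n = psum n.+1 x - psum n x.
Proof. by rewrite /psum big_ord_recr /= addrAC subrr add0r. Qed.

(** Each term of the expansion is a difference of consecutive partial sums, hence tends to 0; the
    lower bound [c] on [|e n|] passes this on to the scalars. *)
Lemma coef_cvg0 x : E x -> coef x @ \oo --> 0.
Proof.
move=> /psum_cvg/cvgn_distP H; have [c [C [c0 Hc]]] := SN.
apply/(cvgn_distP (X := R^o)) => d d0.
have [|N HN] := H (d * c / 2); first by rewrite divr_gt0// mulr_gt0.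
exists N => n Nn; rewrite subr0.
have /andP[cn _] := Hc n.
have : `|coef x n *: e n| <= d * c.
  rewrite coef_psumB (splitr (d * c)) (le_trans (ler_distD x _ _))// lerD//.
    by apply: HN; exact: leqW.
  by rewrite distrC; exact: HN.
rewrite normrZ => h; rewrite -(ler_pM2r c0); apply: le_trans h.
by rewrite ler_wpM2l.
Qed.

Definition greedy_indices x m : seq nat := [seq greedy_rho e x n | n <- iota 0 m].

Lemma greedy_rhoP x : E x -> natural_greedy_ordering (coef x) (greedy_rho e x).
Proof.
move=> Ex; apply: ClassicalEpsilon.epsilon_spec.
by apply: exists_natural_greedy_ordering; exact: coef_cvg0.
Qed.

Lemma size_greedy_indices x m : size (greedy_indices x m) = m.
Proof. by rewrite size_map size_iota. Qed.

Lemma greedy_indicesP x m : E x -> greedy_set (coef x) (greedy_indices x m).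
Proof.
move=> /greedy_rhoP[inj [sup ord]]; split; first by rewrite map_inj_uniq// iota_uniq.
move=> _ j /mapP[k + ->] jA /sup[l jE]; rewrite mem_iota add0n => km.
rewrite -jE; apply: ord; apply: (leq_trans km); rewrite leqNgt; apply: contra jA => lm.
by apply/mapP; exists l; rewrite // mem_iota.
Qed.

Lemma greedy_sumE x m : greedy_sum e x m = \sum_(i <- greedy_indices x m) coef x i *: e i.
Proof.
rewrite /greedy_sum /greedy_indices big_map.
by rewrite -(big_mkord xpredT (fun n => coef x (greedy_rho e x n) *: e (greedy_rho e x n)))
  /index_iota subn0.
Qed.

(** This is how greedy sums of modified vectors are computed: it suffices to exhibit a greedy set,
    without knowing [greedy_rho]. *)
Lemma greedy_sum_set x A : E x -> greedy_set (coef x) A ->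
  greedy_sum e x (size A) = \sum_(i <- A) coef x i *: e i.
Proof.
move=> Ex gA; rewrite greedy_sumE; apply: greedy_set_sum => //; last exact: size_greedy_indices.
exact: greedy_indicesP.
Qed.

Lemma greedy_sum0 x : greedy_sum e x 0 = 0.
Proof. by rewrite /greedy_sum big_ord0. Qed.

Lemma cspan_greedy_sum x m : E (greedy_sum e x m).
Proof. by rewrite greedy_sumE; exact: cspan_sum. Qed.

Lemma greedy_sumZ (t : R) x m : t != 0 -> E x -> greedy_sum e (t *: x) m = t *: greedy_sum e x m.
Proof.
move=> t0 Ex; rewrite -{1}(size_greedy_indices x m) greedy_sum_set; last 2 first.
- exact: cspanZ.
- rewrite (_ : coef _ = fun i => t * coef x i); last by apply/funext => i; rewrite coefZ.
  by apply: greedy_set_scale => //; exact: greedy_indicesP.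
by rewrite greedy_sumE scaler_sumr; apply: eq_bigr => i _; rewrite coefZ// scalerA.
Qed.

(** Erasing the coefficients outside [P] leaves the order of the surviving ones unchanged. *)
Lemma greedy_sum_restrict x x' (P : pred nat) m : E x -> E x' ->
  (forall i, coef x' i = if P i then coef x i else 0) ->
  greedy_sum e x' (count P (greedy_indices x m)) =
  \sum_(i <- greedy_indices x m | P i) coef x i *: e i.
Proof.
move=> Ex Ex' x'E; rewrite -size_filter greedy_sum_set//; last first.
  by apply: greedy_set_restrict x'E; exact: greedy_indicesP.
by rewrite big_filter; apply: eq_bigr => i Pi; rewrite x'E Pi.
Qed.

Lemma sum_below A N (v : nat -> X) : uniq A ->
  \sum_(i <- A | (i < N)%N) v i = \sum_(i < N | (i : nat) \in A) v i.
Proof.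
move=> uA; rewrite -(big_mkord (fun i => i \in A) v) -[LHS]big_filter -[RHS]big_filter.
apply: perm_big; apply: uniq_perm; rewrite ?filter_uniq ?iota_uniq// => i.
by rewrite !mem_filter mem_index_iota /= andbC.
Qed.

End BasicSequence.

(** * Uniform boundedness of the partial sum projections *)

Lemma half_expn_small (R : realType) (C d : R) : 0 < d ->
  exists k, forall n, (k <= n)%N -> C * 2^-1 ^+ n <= d.
Proof.
move=> d0; have h : `|2^-1 : R| < 1 by rewrite ger0_norm ?invr_ge0// invf_lt1// ltr1n.
have [k Hk] := (cvgn_distP (X := R^o) _ _).1 (cvg_geometric C h) d d0.
by exists k => n /Hk; rewrite subr0 => /(le_trans (ler_norm _)).
Qed.

Section BasisConstant.
Variables (R : realType) (X : completeNormedModType R) (e : nat -> X).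
Hypotheses (SN : seminormalized e) (BS : basic_seq e).
Implicit Types (x y u : X).

Local Notation E := (cspan e).
Local Notation coef := (coef e).
Local Notation psum := (psum e).

(** Partial sums that are Cauchy uniformly in [N] have Cauchy coefficients. The uniformity allows
    the limits in [j] and [N] to be exchanged, so the limit coefficients [b] expand [u]. *)
Lemma psum_limit (s : nat -> X) u (eps : nat -> R) : (forall k, E (s k)) ->
  s @ \oo --> u -> (forall d, 0 < d -> exists k, forall n, (k <= n)%N -> eps n <= d) ->
  (forall k j N, (k <= j)%N -> `|psum N (s j) - psum N (s k)| <= eps k) ->
  forall k N, `|psum N u - psum N (s k)| <= eps k.
Proof.
move=> Es su eps0 H; have [c [C [c0 Hc]]] := SN.
have coef_cauchy n : exists l : R^o, (fun j => coef (s j) n : R^o) @ \oo --> l.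
  apply: cauchy_cvgn => d d0.
  have [|k Hk] := eps0 (d * c / 2); first by rewrite divr_gt0// mulr_gt0.
  exists k => j kj; have /andP[cn _] := Hc n.
  rewrite -(ler_pM2r c0).
  apply: (@le_trans _ _ `|(coef (s j) n - coef (s k) n) *: e n|).
    by rewrite normrZ ler_wpM2l.
  rewrite scalerBl !coef_psumB.
  rewrite (_ : _ - _ - _ = (psum n.+1 (s j) - psum n.+1 (s k)) -
    (psum n (s j) - psum n (s k))); last by rewrite !opprD !opprK addrACA.
  rewrite (le_trans (ler_normB _ _))// (splitr (d * c)) lerD//.
    by apply: le_trans (H _ _ _ kj) _; exact: Hk.
  by apply: le_trans (H _ _ _ kj) _; exact: Hk.
have [b Hb] := choice coef_cauchy.
pose T N : X := \sum_(i < N) b i *: e i.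
have sT N : (fun j => psum N (s j)) @ \oo --> T N.
  elim: N => [|N IH].
    rewrite /T /psum big_ord0; under eq_fun do rewrite big_ord0; exact: cvg_cst.
  rewrite /T big_ord_recr /=.
  rewrite (_ : (fun j => _) = (fun j => psum N (s j)) \+ (fun j => coef (s j) N *: e N)).
    by apply: cvgD => //; apply: cvgZr_tmp; exact: Hb.
  by apply/funext => j; rewrite /psum big_ord_recr.
have TH k N : `|T N - psum N (s k)| <= eps k.
  by apply: (cvgn_le_norm (sT N)); exists k => j kj; exact: H.
have ub : expansion e u b.
  apply/cvgn_distP => d d0.
  have d3 : 0 < d / 3 by rewrite divr_gt0.
  have [k0 Hk0] := eps0 _ d3.
  have [k1 Hk1] := (cvgn_distP s u).1 su _ d3.
  pose k := maxn k0 k1.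
  have [N HN] := (cvgn_distP _ _).1 (psum_cvg BS (Es k)) _ d3.
  (* Three errors of size [d / 3]: from [T n] to [psum n (s k)], from there to [s k], and from [s k]
     to [u]. *)
  exists N => n Nn; rewrite -/(T n).
  have -> : d = d / 3 + d / 3 + d / 3 by field.
  rewrite (le_trans (ler_distD (s k) _ _))// lerD//; last exact/Hk1/leq_maxr.
  rewrite (le_trans (ler_distD (psum n (s k)) _ _))// lerD//; last exact: HN.
  by apply: (le_trans (TH _ _)); exact/Hk0/leq_maxl.
move=> k N; have -> : psum N u = T N by rewrite /psum (coef_unique BS ub).
exact: TH.
Qed.

Lemma psum_bounded x : E x -> exists n : nat, forall N, `|psum N x| <= n%:R.
Proof.
move=> Ex; have [M [_ HM]] := cvg_seq_bounded (cvgP _ (psum_cvg BS Ex)).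
exists (Num.truncn (M + 1)).+1 => N.
apply: (le_trans (HM (M + 1) _ N _)) => //; first by rewrite ltrDl.
by rewrite ltW// truncnS_gt.
Qed.

Lemma closed_cspan_ball y (r : R) : 0 < r -> closed [set x | E x /\ `|x - y| <= r].
Proof.
move=> r0; rewrite (_ : mkset _ = E `&` closed_ball y r).
  by apply: closedI; [exact: closed_closure|exact: closed_ball_closed].
rewrite closed_ballE//; apply/seteqP; split=> x [Ex h]; split=> //; move: h;
  by rewrite /closed_ball_ /= distrC.
Qed.

Definition bounded_psums (M : R) : set X := [set x | E x /\ forall N, `|psum N x| <= M].

(** The sets [bounded_psums n] cover the span, since convergent partial sums are bounded. If none
    were dense in a ball, every ball would contain a smaller one missing the given set, against the
    nested set lemma. *)
Lemma somewhere_dense_bounded_psums : exists (n : nat) y (r : R), [/\ E y, 0 < r &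
  forall y' (d : R), E y' -> `|y' - y| < r -> 0 < d ->
    exists2 x, bounded_psums n%:R x & `|x - y'| <= d].
Proof.
apply: contrapT => no.
pose cball y (r : R) := [set x | E x /\ `|x - y| <= r].
pose FF := [set F | exists y (r : R), [/\ E y, 0 < r & F = cball y r]].
have [|||x [Ex _] Hx] := @nested_closed_sets R X FF (fun n => bounded_psums n%:R) (cball 0 1).
- move=> _ [y [r [Ey r0 ->]]]; split; last by exists y; split=> //; rewrite subrr normr0 ltW.
  exact: closed_cspan_ball.
- move=> _ n [y [r [Ey r0 ->]]]; apply: contrapT => no'; apply: no.
  exists n, y, r; split=> // y' d Ey' y'r d0; apply: contrapT => no''; apply: no'.
  pose r' := Num.min d (Num.min (r - `|y' - y|) (n.+1%:R^-1 / 2)).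
  have r'0 : 0 < r' by rewrite !lt_min d0 subr_gt0 y'r/= divr_gt0// invr_gt0.
  have : r' <= r' by []. rewrite {2}/r' !le_min => /and3P[r'd r'r r'n].
  exists (cball y' r'); split; first by exists y', r'.
  + move=> x [Ex xy']; split=> //; apply: le_trans (ler_distD y' _ _) _.
    by rewrite -lerBrDr (le_trans xy').
  + rewrite -subset0 => x [[Ex xy'] Kx]; apply: no''; exists x => //.
    exact: le_trans xy' r'd.
  + move=> x1 x2 [_ h1] [_ h2]; apply: le_trans (ler_distD y' _ _) _.
    by rewrite (splitr n.+1%:R^-1) lerD//; [|rewrite distrC]; apply: le_trans r'n.
- by exists 0, 1; split=> //; exact: cspan0.
by have [n Hn] := psum_bounded Ex; exact: (Hx n).
Qed.

(** Approximating [y + t *: u] and [y] inside the good ball, subtracting and dividing by [t]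
    approximates [u]. *)
Lemma dense_bounded_psums : exists2 L : R, 0 <= L &
  forall u (d : R), E u -> 0 < d ->
    exists2 x, bounded_psums (L * `|u|) x & `|u - x| <= d.
Proof.
have [n [y [r [Ey r0 H]]]] := somewhere_dense_bounded_psums.
exists (4 * n%:R / r) => [|u d Eu d0]; first by rewrite divr_ge0 ?mulr_ge0// ltW.
have [->|u0] := eqVneq u 0.
  exists 0; last by rewrite subrr normr0 ltW.
  split=> [|N]; first exact: cspan0.
  rewrite normr0 mulr0 /psum big1 ?normr0// => i _.
  by rewrite coef0// scale0r.
have u1 : 0 < `|u| by rewrite normr_gt0.
(* This [t] gives [t *: u] norm [r / 2]; the bound [2 n / t] then equals [L * |u|] with
   [L = 4 n / r]. *)
pose t := r / 2 / `|u|.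
have t0 : 0 < t by rewrite !divr_gt0.
have tN : t^-1 = 2 / r * `|u| by rewrite /t; field; rewrite !gt_eqF.
have [|||x1 [Ex1 Hx1] hx1] := H (y + t *: u) (t * d / 2).
- by apply: cspanD => //; exact: cspanZ.
- rewrite addrAC subrr add0r normrZ gtr0_norm// /t divfK ?gt_eqF//.
  by rewrite ltr_pdivrMr// ltr_pMr// ltr1n.
- by rewrite divr_gt0// mulr_gt0.
have [||x2 [Ex2 Hx2] hx2] := H y (t * d / 2) Ey.
- by rewrite subrr normr0.
- by rewrite divr_gt0// mulr_gt0.
have E12 : E (x1 - x2) by exact: cspanB.
exists (t^-1 *: (x1 - x2)).
  split=> [|N]; first exact: cspanZ.
  rewrite psumZ// normrZ gtr0_norm ?invr_gt0// psumB//.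
  rewrite (_ : _ * `|u| = t^-1 * (n%:R + n%:R)); last by rewrite tN; field; rewrite gt_eqF.
  by rewrite ler_pM2l ?invr_gt0// (le_trans (ler_normB _ _))// lerD.
rewrite -(ler_pM2l t0) -{1}(gtr0_norm t0) -normrZ scalerBr scalerA mulfV ?gt_eqF// scale1r.
rewrite (_ : _ - _ = (x2 - y) - (x1 - (y + t *: u))).
  by rewrite (splitr (t * d)) (le_trans (ler_normB _ _))// lerD.
by rewrite !opprB !addrA subrK [x2 + _]addrC.
Qed.

(** Successive approximation as in the open mapping theorem: [u] is a series of vectors whose
    partial sums are bounded geometrically, and [psum_limit] passes the total bound [2 L |u|] to
    [u]. *)
Lemma basis_constant : exists2 B : R, 1 <= B &
  forall x N, E x -> `|psum N x| <= B * `|x|.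
Proof.
have [L L0 H] := dense_bounded_psums.
exists (2 * L + 1) => [|u N Eu]; first by rewrite lerDr mulr_ge0.
have [u0|u0] := eqVneq u 0.
  rewrite u0 normr0 mulr0 /psum big1 ?normr0// => i _.
  by rewrite coef0// scale0r.
have nu : 0 < `|u| by rewrite normr_gt0.
have [pick Hp] : {f : X * nat -> X & forall p, E p.1 ->
    bounded_psums (L * `|p.1|) (f p) /\ `|p.1 - f p| <= `|u| * 2^-1 ^+ p.2.+1}.
  apply: (@choice (X * nat) X (fun p x => E p.1 ->
    bounded_psums (L * `|p.1|) x /\ `|p.1 - x| <= `|u| * 2^-1 ^+ p.2.+1)) => -[v k] /=.
  have [Ev|nE] := pselect (E v); last by exists 0.
  have [|x ? ?] := H v (`|u| * 2^-1 ^+ k.+1) Ev; last by exists x.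
  by rewrite mulr_gt0// exprn_gt0// invr_gt0.
(* [v k] is the remainder after [k] approximations, of norm at most [|u| / 2^k]. *)
pose v := fix v k := if k is k'.+1 then v k' - pick (v k', k') else u.
have Ev k : E (v k).
  elim: k => //= k IH; apply: cspanB => //.
  by have [[]] := Hp (v k, k) IH.
have vb k : `|v k| <= `|u| * 2^-1 ^+ k.
  by case: k => [|k]; [rewrite expr0 mulr1|have [_] := Hp (v k, k) (Ev k)].
have pb k M : `|psum M (pick (v k, k))| <= L * `|u| * 2^-1 ^+ k.
  have [[_ h] _] := Hp (v k, k) (Ev k); apply: le_trans (h M) _.
  by rewrite -mulrA ler_wpM2l ?vb.
pose s k := u - v k.
have Es k : E (s k) by exact: cspanB.
have sS k M : psum M (s k.+1) = psum M (s k) + psum M (pick (v k, k)).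
  have Ep : E (pick (v k, k)) by have [[]] := Hp (v k, k) (Ev k).
  by rewrite -psumD// /s /= opprB addrA addrAC.
have sb k j M : (k <= j)%N -> `|psum M (s j) - psum M (s k)| <=
    2 * L * `|u| * (2^-1 ^+ k - 2^-1 ^+ j).
  move=> /subnK <-; elim: (j - k)%N => [|i IH]; first by rewrite !subrr normr0 mulr0.
  rewrite addSn sS addrAC; apply: le_trans (ler_normD _ _) _.
  apply: le_trans (lerD IH (pb _ _)) _; rewrite exprS.
  by rewrite -subr_ge0 le_eqVlt; apply/orP; left; apply/eqP; field.
have := @psum_limit s u (fun k => 2 * L * `|u| * 2^-1 ^+ k) Es _ _ _ 0%N N.
rewrite (_ : s 0%N = 0) ?expr0 /=; last by rewrite /s subrr.
rewrite mulr1 (_ : psum N 0 = 0); last first.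
  by rewrite /psum big1// => i _; rewrite coef0// scale0r.
rewrite subr0 => h; apply: le_trans (h _ _ _) _.
- apply/cvgn_distP => d /(half_expn_small `|u|)[k Hk]; exists k => n /Hk.
  by apply: le_trans; rewrite /s addrAC subrr add0r normrN.
- by move=> d /half_expn_small; exact.
- move=> k j M kj; apply: le_trans (sb k j M kj) _.
  by rewrite ler_wpM2l ?mulr_ge0// gerBl exprn_ge0// invr_ge0.
by rewrite [leRHS]mulrDl mul1r lerDl.
Qed.


End BasisConstant.

(** * Tails and heads of greedy sums *)

Section GreedySums.
Variables (R : realType) (X : completeNormedModType R) (jn : X -> X -> X) (e : nat -> X).
Hypotheses (BL : is_banach_lattice jn) (SN : seminormalized e) (BS : basic_seq e).
Implicit Types (x y z w : X).

Local Notation "x <=| y" := (lle jn x y) (at level 70).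
Local Notation labs := (labs jn).
Local Notation E := (cspan e).
Local Notation coef := (coef e).
Local Notation psum := (psum e).
Local Notation greedy_sum := (greedy_sum e).

(** The supremum runs over the greedy sums of lengths 1 to [m + 1], because [jsup] starts at index
    0. *)
Definition gmax x m : X := jsup jn (fun n => labs (greedy_sum x n.+1)) m.

Lemma gmax_ge0 x m : 0 <=| gmax x m.
Proof. exact: (lle_trans BL (labs_ge0 BL _) (jsup_ub BL (fun n => _) (leq0n m))). Qed.

Lemma greedy_le_gmax x n m : (n <= m.+1)%N -> labs (greedy_sum x n) <=| gmax x m.
Proof.
case: n => [_|n nm]; first by rewrite greedy_sum0 labs0//; exact: gmax_ge0.
exact: (jsup_ub BL (fun n => labs (greedy_sum x n.+1))).
Qed.

Lemma gmax_lub x m w : (forall n, (n <= m.+1)%N -> labs (greedy_sum x n) <=| w) ->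
  gmax x m <=| w.
Proof. by move=> H; apply: jsup_lub => // n nm; exact: H. Qed.

Lemma gmaxZ (t : R) x m : 0 < t -> E x -> gmax (t *: x) m = t *: gmax x m.
Proof.
move=> t0 Ex; rewrite /gmax -jsupZ ?ltW//; apply: eq_jsup => n.
by rewrite greedy_sumZ ?gt_eqF// labsZ ?ltW.
Qed.

(** Subtracting the first [k] greedy terms erases exactly their coefficients, so the next [m]
    indices form a greedy set of the difference. *)
Lemma greedy_sum_tail x k m : E x ->
  greedy_sum (x - greedy_sum x k) m = greedy_sum x (k + m) - greedy_sum x k.
Proof.
move=> Ex; set A := greedy_indices e x k.
pose B := [seq greedy_rho e x n | n <- iota k m].
have AB : greedy_indices e x (k + m) = A ++ B.
  by rewrite /greedy_indices iotaD map_cat.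
have [uAB _] := greedy_indicesP SN BS (k + m) Ex.
rewrite AB cat_uniq -/A in uAB; case/and3P: uAB => uA dAB uB.
have nA i : i \in B -> i \notin A.
  by move=> iB; apply: contra dAB => iA; apply/hasP; exists i.
have fB : [seq i <- A ++ B | i \notin A] = B.
  rewrite filter_cat (eq_in_filter (a2 := pred0)); last by move=> i /= ->.
  by rewrite filter_pred0 /=; apply/all_filterP/allP.
have coefE i : coef (x - greedy_sum x k) i = if i \notin A then coef x i else 0.
  rewrite coefB//; last exact: cspan_greedy_sum.
  rewrite greedy_sumE coef_sum// -/A.
  by case: (i \in A); rewrite /= ?subrr ?subr0.
have gB : greedy_set (coef (x - greedy_sum x k)) B.
  rewrite -fB -AB; apply: greedy_set_restrict coefE; exact: greedy_indicesP.
have <- : size B = m by rewrite size_map size_iota.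
rewrite greedy_sum_set//; last by apply: cspanB => //; exact: cspan_greedy_sum.
rewrite [size B]size_map size_iota big_seq.
under eq_bigr => i iB do rewrite coefE nA//.
by rewrite -big_seq !greedy_sumE AB big_cat /= addrAC subrr add0r.
Qed.

(** Beyond [m0] every nonzero coefficient below [N] has been selected; the selected indices from [N]
    on are greedy for the remainder. *)
Lemma greedy_sum_head x N : E x -> exists m0, forall m, (m0 <= m)%N ->
  exists2 n, (n <= m)%N & greedy_sum x m = psum N x + greedy_sum (x - psum N x) n.
Proof.
move=> Ex; have [inj [sup _]] := greedy_rhoP SN BS Ex.
have [m0 Hm0] : exists m0, forall i, (i < N)%N -> coef x i != 0 -> i \in greedy_indices e x m0.
  elim: N => [|N [m0 IH]]; first by exists 0%N.
  have [aN|aN] := eqVneq (coef x N) 0.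
    exists m0 => i; rewrite ltnS leq_eqVlt => /orP[/eqP->|]; first by rewrite aN eqxx.
    exact: IH.
  have [j jN] := sup _ aN; exists (maxn m0 j.+1) => i.
  rewrite ltnS leq_eqVlt => /orP[/eqP-> _|/IH h /h /mapP[l lm ->]]; apply/mapP.
    by exists j => //; rewrite mem_iota add0n leq_maxr.
  exists l => //; move: lm; rewrite !mem_iota !add0n => lm.
  exact: leq_trans lm (leq_maxl _ _).
exists m0 => m m0m; set A := greedy_indices e x m.
have mA i : (i < N)%N -> coef x i != 0 -> i \in A.
  move=> iN ai; have /mapP[l + ->] := Hm0 i iN ai; rewrite mem_iota add0n => lm.
  by apply: map_f; rewrite mem_iota add0n (leq_trans lm).
exists (count (leq N) A); first by rewrite -[leqRHS](size_greedy_indices e x m) count_size.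
rewrite greedy_sumE (greedy_sum_restrict SN BS m Ex); last 2 first.
- by apply: cspanB => //; exact: cspan_psum.
- move=> i; rewrite coefB//; last exact: cspan_psum.
  by rewrite coef_psum//; case: ltnP; rewrite ?subrr ?subr0.
rewrite (bigID (fun i => (i < N)%N)) /=; congr (_ + _); last first.
  by apply: eq_bigl => i; rewrite -leqNgt.
rewrite sum_below; last by case: (greedy_indicesP SN BS m Ex).
rewrite /psum [RHS](bigID (fun i : 'I_N => (i : nat) \in A)) /= [X in _ + X]big1 ?addr0// => i.
by move=> /(contra (mA _ (ltn_ord i))); rewrite negbK => /eqP ->; rewrite scale0r.
Qed.

(** * Uniform convergence from the bound on maximal greedy sums *)

Section GreedyUniform.
Variable C : R.
Hypotheses (C1 : 1 <= C) (HC : forall x, E x -> forall m, `|gmax x m| <= C * `|x|).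

Lemma norm_greedy_sum x m : E x -> `|greedy_sum x m| <= C * `|x|.
Proof.
move=> Ex; apply: le_trans (HC Ex m); apply: (lle_norm BL).
by apply: greedy_le_gmax.
Qed.

(** By [greedy_sum_head] the error is at most [C + 1] times the norm of [x - psum N x]. *)
Lemma greedy_sum_cvg x : E x -> greedy_sum x @ \oo --> x.
Proof.
move=> Ex; apply/cvgn_distP => d d0.
have C0 : 0 < C + 1 by rewrite ltr_wpDl// (le_trans ler01).
have [|N HN] := (cvgn_distP _ _).1 (psum_cvg BS Ex) (d / (C + 1)).
  by rewrite divr_gt0.
have [m0 Hm0] := greedy_sum_head N Ex.
exists m0 => m /Hm0[n _ ->]; have := HN N (leqnn _).
rewrite ler_pdivlMr// => h; apply: le_trans h.
rewrite addrAC (le_trans (ler_normD _ _))// mulrDr mulr1 [leRHS]addrC lerD//.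
rewrite mulrC distrC; apply: norm_greedy_sum.
by apply: cspanB => //; exact: cspan_psum.
Qed.

Lemma greedy_sum_ucvg x : E x -> u_cvg jn (greedy_sum x) x.
Proof.
move=> Ex.
have C0 : 0 < C + 1 by rewrite ltr_wpDl// (le_trans ler01).
have h0 n : 0 < 2^-1 ^+ n :> R by rewrite exprn_gt0// invr_gt0.
(* The rate [4^-j] leaves [2^-j] after weighting by [2^j]; [j <= k j] ensures that the blocks reach
   every large index. *)
have [k Hk] : {k : nat -> nat & forall j, (j <= k j)%N /\
    `|x - greedy_sum x (k j)| <= 4^-1 ^+ j / (C + 1)}.
  apply: (@choice nat nat (fun j k => (j <= k)%N /\
    `|x - greedy_sum x k| <= 4^-1 ^+ j / (C + 1))) => j.
  have [|N HN] := (cvgn_distP _ _).1 (greedy_sum_cvg Ex) (4^-1 ^+ j / (C + 1)).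
    by rewrite divr_gt0// exprn_gt0// invr_gt0.
  by exists (maxn N j); rewrite leq_maxr distrC; split=> //; exact/HN/leq_maxl.
pose y j := x - greedy_sum x (k j).
have Ey j : E (y j) by apply: cspanB => //; exact: cspan_greedy_sum.
(* [v j] dominates [|greedy_sum x n - x|] for [n] between [k j] and [k j.+1], by
   [greedy_sum_tail]. *)
pose v j := labs (y j) + gmax (y j) (k j.+1).
have v_ge0 j : 0 <=| v j.
  by apply: ladd_ge0 => //; [exact: labs_ge0|exact: gmax_ge0].
have vn j : `|v j| <= 4^-1 ^+ j.
  apply: le_trans (ler_normD _ _) _; rewrite norm_labs//.
  apply: le_trans (lerD (lexx _) (HC (Ey j) _)) _.
  by have [_] := Hk j; rewrite ler_pdivlMr// mulrDr mulr1 addrC mulrC.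
pose t j := 2 ^+ j *: v j.
have t_ge0 j : 0 <=| t j.
  by rewrite -(scaler0 _ (2 ^+ j : R)); apply: lleZ => //; rewrite exprn_ge0.
(* The weighted series converges absolutely, and its sum [w] lies above each of its nonnegative
   terms. *)
have [w tw] : exists w : X, series t @ \oo --> w.
  suff /normed_cvg h : cvgn [normed series t] by exists (lim (series t @ \oo)).
  apply: (@series_le_cvg _ _ (geometric 1 2^-1)) => //=.
  - move=> n; rewrite mul1r normrZ ger0_norm ?exprn_ge0//.
    apply: (le_trans (ler_wpM2l _ (vn n))); first by rewrite exprn_ge0.
    rewrite -exprMn (_ : 2 * 4^-1 = 2^-1)//; by field.
  - by apply: is_cvg_geometric_series; rewrite ger0_norm ?invr_ge0// invf_lt1// ltr1n.
have sincr m n : (m <= n)%N -> series t m <=| series t n.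
  move=> /subnK <-; elim: (n - m)%N => [|i IH]; first exact: lle_refl.
  apply: (lle_trans BL IH); rewrite addSn seriesSr -{1}[series t _]addr0.
  by apply: lleD => //; exact: lle_refl.
have sw n : series t n <=| w by apply: (lle_cvg_incr BL tw) => m; exact: sincr.
have s_ge0 n : 0 <=| series t n.
  by have := sincr 0%N n (leq0n _); rewrite {1}/series /= big_geq.
have tw' n : t n <=| w.
  apply: (lle_trans BL _ (sw n.+1)); rewrite seriesSr -{1}[t n]add0r.
  by apply: lleD => //; exact: lle_refl.
have vw n : v n <=| 2^-1 ^+ n *: w.
  have -> : v n = 2^-1 ^+ n *: t n.
    by rewrite scalerA -exprMn mulVf ?pnatr_eq0// expr1n scale1r.
  by apply: lleZ => //; exact: ltW.
have w_ge0 : 0 <=| w by apply: (lle_trans BL (s_ge0 0%N)).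
exists w, (fun j => 2^-1 ^+ j); split=> //; split=> //; split; last split.
- by move=> i j ij; rewrite ler_wiXn2l// ?invr_ge0// invf_le1// ler1n.
- apply/(cvgn_distP (X := R^o)) => d /(half_expn_small 1)[k0 Hk0]; exists k0 => n /Hk0.
  by rewrite mul1r subr0 ger0_norm// ltW.
move=> j; exists (k j) => n kn.
(* The least such [l] is the block of [n]: minimality, or [k j <= n] when [l = j], gives [k l <= n].
   Monotonicity of [k] is not assumed. *)
have ex : exists l, (j <= l)%N && (n < k l.+1)%N.
  exists (maxn j n); rewrite leq_maxl /=; have [h _] := Hk (maxn j n).+1.
  by apply: leq_trans h; rewrite ltnS leq_maxr.
case: (ex_minnP ex) => l /andP[jl nl] lmin.
have kl : (k l <= n)%N.
  move: jl lmin; rewrite leq_eqVlt => /orP[/eqP<-//|]; case: l nl => // l nl jl lmin.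
  rewrite leqNgt; apply/negP => h.
  by have := lmin l; rewrite -ltnS jl h ltnn => /(_ isT).
apply: (@lle_trans _ _ _ BL _ (v l)).
  have -> : greedy_sum x n - x = greedy_sum (y l) (n - k l) - y l.
    by rewrite greedy_sum_tail// subnKC// opprB addrA subrK.
  apply: (lle_trans BL (labsB BL _ _)); rewrite addrC; apply: lleD => //; first exact: lle_refl.
  by apply: greedy_le_gmax; rewrite (leq_trans (leq_subr _ _))// ltnW// ltnW.
apply: (lle_trans BL (vw l)); apply: (lleZl BL w_ge0).
by rewrite ler_wiXn2l// ?invr_ge0// invf_le1// ler1n.
Qed.

End GreedyUniform.
End GreedySums.

(** The nonzero values of [z] dominate those of [w], and nonzero values of [a] below [N'] dominate
    its tail. Indices with zero value are filtered out because they need not precede the remaining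
    nonzero ones. *)
Lemma greedy_set_glue (R : realType) (a z w : nat -> R) (N N' : nat) (W : seq nat) :
  (forall i, (i < N)%N -> a i = z i) ->
  (forall i, (N <= i < N')%N -> a i = w i) ->
  (forall i, w i != 0 -> (N <= i < N')%N) ->
  (forall i j, z i != 0 -> `|w j| < `|z i|) ->
  (forall i j, (i < N')%N -> a i != 0 -> (N' <= j)%N -> `|a j| < `|a i|) ->
  (N <= N')%N -> greedy_set w W ->
  greedy_set a ([seq i <- iota 0 N | z i != 0] ++ [seq i <- W | w i != 0]).
Proof.
move=> az aw ws zw gap NN' [uW gW]; split.
  rewrite cat_uniq !filter_uniq ?iota_uniq//= andbT; apply/hasPn => i.
  rewrite !mem_filter mem_iota /= => /andP[/ws/andP[Ni _] _].
  by rewrite add0n ltnNge Ni andbF.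
move=> i j; rewrite !mem_cat !mem_filter !mem_iota /= !add0n negb_or => iA /andP[jz jw] aj.
have Nj : (N <= j)%N.
  by rewrite leqNgt; apply: contra jz => jN; rewrite jN -az ?aj.
have [iN' ai] : (i < N')%N /\ a i != 0.
  case/orP: iA => /andP[zi iN]; first by rewrite az// (leq_trans iN).
  by have /andP[Ni iN'] := ws _ zi; rewrite aw// Ni.
have [jN'|jN'] := ltnP j N'; last by left; exact: gap.
have ajw : a j = w j by rewrite aw ?Nj.
case/orP: iA => /andP[zi iN]; first by left; rewrite ajw az ?zw.
rewrite /beats ajw aw ?ws//; apply: gW => //; last by rewrite -ajw.
by move: jw; rewrite -ajw aj.
Qed.

Lemma nonzero_gap (R : realType) (a : nat -> R) N :
  exists2 mu : R, 0 < mu & forall i, (i < N)%N -> a i != 0 -> mu <= `|a i|.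
Proof.
elim: N => [|N [mu mu0 H]]; first by exists 1.
have [aN|aN] := eqVneq (a N) 0.
  exists mu => // i; rewrite ltnS leq_eqVlt => /orP[/eqP->|]; last exact: H.
  by rewrite aN eqxx.
exists (Num.min mu `|a N|); first by rewrite lt_min mu0 normr_gt0.
move=> i; rewrite ltnS leq_eqVlt ge_min => /orP[/eqP->|iN ai]; first by rewrite lexx orbT.
by rewrite H.
Qed.

(** * The gliding hump construction *)

Section GlidingHump.
Variables (R : realType) (X : completeNormedModType R) (jn : X -> X -> X) (e : nat -> X).
Hypotheses (BL : is_banach_lattice jn) (SN : seminormalized e) (BS : basic_seq e).
Implicit Types (x y z w : X).

Local Notation "x <=| y" := (lle jn x y) (at level 70).
Local Notation labs := (labs jn).
Local Notation E := (cspan e).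
Local Notation coef := (coef e).
Local Notation psum := (psum e).
Local Notation greedy_sum := (greedy_sum e).
Local Notation gmax := (gmax jn e).

Variable B : R.
Hypotheses (B1 : 1 <= B) (HB : forall x N, E x -> `|psum N x| <= B * `|x|).

Lemma norm_coef_term x n : E x -> `|coef x n *: e n| <= 2 * B * `|x|.
Proof.
move=> Ex; rewrite coef_psumB (le_trans (ler_normB _ _))//.
by rewrite -mulrA mulr_natl mulr2n lerD// HB.
Qed.

Lemma norm_coef_le : exists2 D : R, 0 < D & forall x n, E x -> `|coef x n| <= D * `|x|.
Proof.
have [c [C [c0 Hc]]] := SN; have B0 : 0 < B := lt_le_trans ltr01 B1.
exists (2 * B / c) => [|x n Ex]; first by rewrite divr_gt0// mulr_gt0.
have /andP[cn _] := Hc n; rewrite mulrAC ler_pdivlMr//.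
apply: le_trans (norm_coef_term n Ex); rewrite normrZ.
by rewrite ler_wpM2l.
Qed.

(** Dropping the first [N] coordinates costs at most [N] terms of norm [2 B |x|]. The cut at [N']
    lies past every index used by the first [m + 1] greedy terms, so it costs nothing. *)
Lemma gmax_truncate x N m : E x -> exists2 N', (N <= N')%N &
  `|gmax x m| <= N%:R * (2 * B * `|x|) + `|gmax (psum N' x - psum N x) m|.
Proof.
move=> Ex; pose N' := maxn N (\max_(i <- greedy_indices e x m.+1) i).+1.
exists N'; first exact: leq_maxl.
set w := psum N' x - psum N x.
have Ew : E w by apply: cspanB => //; exact: cspan_psum.
have coef_w i : coef w i = if (N <= i < N')%N then coef x i else 0.
  rewrite coefB//; [|exact: cspan_psum|exact: cspan_psum].
  rewrite !coef_psum//; case: (ltnP i N) => iN /=; last by rewrite subr0.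
  by rewrite (leq_trans iN (leq_maxl _ _)) subrr.
pose r := \sum_(i < N) labs (coef x i *: e i).
have gr : gmax x m <=| r + gmax w m.
  apply: gmax_lub => // n nm; set A := greedy_indices e x n.
  have [uA _] := greedy_indicesP SN BS n Ex.
  have AN' i : i \in A -> (i < N')%N.
    move=> /mapP[l ln ->]; rewrite leq_max ltnS; apply/orP; right.
    apply: (@leq_bigmax_seq _ _ xpredT id) => //; apply: map_f.
    by move: ln; rewrite !mem_iota !add0n => /leq_trans; exact.
  rewrite greedy_sumE -/A (bigID (fun i => (i < N)%N)) /=.
  apply: (lle_trans BL (labsD BL _ _)); apply: lleD => //.
    rewrite sum_below//; apply: (lle_trans BL (labs_sum BL _ _ _)).
    rewrite big_mkcond; apply: lle_sum => // i _.
    by case: ifP => _; [exact: lle_refl|exact: labs_ge0].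
  rewrite (_ : \sum_(i <- A | _) _ = greedy_sum w (count (fun i => N <= i < N')%N A)).
    by apply: greedy_le_gmax => //; rewrite (leq_trans (count_size _ _))// size_greedy_indices.
  rewrite (greedy_sum_restrict SN BS n Ex Ew coef_w) big_seq_cond [RHS]big_seq_cond.
  apply: eq_bigl => i; have [/AN' ->|//] := boolP (i \in A).
  by rewrite -leqNgt andbT.
apply: le_trans (lle_norm_pos BL (gmax_ge0 _ BL _ _) gr) _.
apply: le_trans (ler_normD _ _) _; rewrite lerD2r.
apply: le_trans (ler_norm_sum _ _ _) _.
rewrite mulr_natl -[X in _ *+ X](card_ord N) -sumr_const.
by apply: ler_sum => i _; rewrite norm_labs// norm_coef_term.
Qed.

Lemma gmax0 m : gmax 0 m = 0.
Proof.
apply: (lle_anti BL); last exact: gmax_ge0.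
apply: gmax_lub => // n _; rewrite greedy_sumE big1 ?labs0//; first exact: lle_refl.
by move=> i _; rewrite coef0// scale0r.
Qed.

Hypothesis unbdd : forall C : R, 1 <= C ->
  exists2 x, E x & exists m, C * `|x| < `|gmax x m|.

Lemma exists_hump N (d K : R) : 0 < d -> exists w N' m,
  [/\ E w, `|w| <= d, (N <= N')%N, forall i, coef w i != 0 -> (N <= i < N')%N &
      K < `|gmax w m|].
Proof.
move=> d0; have B0 : 0 < B := lt_le_trans ltr01 B1.
(* After scaling [x] to norm [d / (2 B)], the bound [C |x|] becomes the truncation loss [N d] plus
   [|K|] plus a positive remainder. *)
pose C := N%:R * (2 * B) + 2 * B * `|K| / d + 1.
have [|x Ex [m xm]] := unbdd (C := C).
  by rewrite lerDr addr_ge0// ?divr_ge0 ?mulr_ge0// ltW.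
have x0 : x != 0.
  by apply: contraTneq xm => ->; rewrite gmax0 !normr0 mulr0 ltxx.
have nx : 0 < `|x| by rewrite normr_gt0.
pose t := d / (2 * B) / `|x|.
have t0 : 0 < t by rewrite !divr_gt0// mulr_gt0.
have tx : `|t *: x| = d / (2 * B) by rewrite normrZ gtr0_norm// divfK ?gt_eqF.
have Etx : E (t *: x) by exact: cspanZ.
have [N' NN' HN'] := gmax_truncate N m Etx.
exists (psum N' (t *: x) - psum N (t *: x)), N', m; split=> //.
- by apply: cspanB => //; exact: cspan_psum.
- apply: le_trans (ler_normB _ _) _; apply: le_trans (lerD (HB _ Etx) (HB _ Etx)) _.
  by rewrite tx le_eqVlt; apply/orP; left; apply/eqP; field; rewrite gt_eqF.
- move=> i; rewrite coefB//; [|exact: cspan_psum|exact: cspan_psum].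
  rewrite !coef_psum//; case: (ltnP i N) => iN /=.
    by rewrite (leq_trans iN NN') subrr eqxx.
  by case: ltnP; rewrite // subr0 eqxx.
apply: (@le_lt_trans _ _ `|K|); first exact: ler_norm.
rewrite -(ltrD2l (N%:R * (2 * B * `|t *: x|))); apply: lt_le_trans HN'.
rewrite tx gmaxZ// normrZ gtr0_norm//; apply: le_lt_trans (_ : t * (C * `|x|) < _).
  rewrite /C /t -subr_ge0.
  rewrite (_ : _ - _ = d / (2 * B)); first by rewrite divr_ge0 ?mulr_ge0// ltW.
  by field; rewrite !gt_eqF.
by rewrite ltr_pM2l.
Qed.

Variable D : R.
Hypotheses (D0 : 0 < D) (HD : forall x n, E x -> `|coef x n| <= D * `|x|).

(** Freezing the first [N] coordinates keeps the humps already placed intact in all later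
    approximations. *)
Definition hump_set z N (d : R) : set X :=
  [set x | (E x /\ `|x - z| <= d) /\ forall i, (i < N)%N -> coef x i = coef z i].

(** The last condition makes every coefficient of a vector of norm at most [d] smaller than each
    nonzero coefficient of [z]. *)
Definition hump_center z N (d : R) : Prop :=
  [/\ E z, 0 < d, forall i, (N <= i)%N -> coef z i = 0 &
      forall i, coef z i != 0 -> D * d < `|coef z i|].

Lemma closed_hump_set z N (d : R) : 0 < d -> closed (hump_set z N d).
Proof.
move=> d0 x clx.
have Fx : E x /\ `|x - z| <= d.
  apply: (closed_cspan_ball d0) => U Ux; have [y [[Fy _] Uy]] := clx U Ux.
  by exists y.
split=> // i iN; apply/eqP; rewrite -subr_eq0 -normr_le0; apply: ler0_of_leeps => eps eps0.
have [|y [[[Ey _] cy]]] := clx (ball x (eps / D)).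
  by apply: nbhsx_ballx; rewrite divr_gt0.
rewrite -ball_normE /= -cy// -coefB//; last by case: Fx.
move=> h; apply: le_trans (HD _ _) _; first by apply: cspanB => //; case: Fx.
by rewrite mulrC -ler_pdivlMr// ltW.
Qed.

(** For every [x] in the new set, each greedy sum of the hump [w] is a greedy sum of [x] minus [z].
    The margin [|z|] in the size of the hump pays for this subtraction. *)
Lemma hump_step z N (d : R) (n : nat) : hump_center z N d ->
  exists z' N' (d' : R), [/\ hump_center z' N' d', hump_set z' N' d' `<=` hump_set z N d,
    d' <= n.+1%:R^-1 / 2 &
    forall x, hump_set z' N' d' x -> exists M, n%:R < `|gmax x M|].
Proof.
move=> [Ez d0 zN zgap].
have d2 : 0 < d / 2 by rewrite divr_gt0.
have [w [N' [m [Ew wd NN' wN Hm]]]] := exists_hump N (n%:R + `|z|) d2.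
have Ez' : E (z + w) by exact: cspanD.
have coef_z' i : coef (z + w) i = coef z i + coef w i by rewrite coefD.
have w_out i : ~~ (N <= i < N')%N -> coef w i = 0.
  by apply: contraNeq => /wN.
have z'N i : (N' <= i)%N -> coef (z + w) i = 0.
  move=> iN'; rewrite coef_z' zN ?(leq_trans NN')// w_out ?addr0//.
  by rewrite (leqNgt _ i) negb_and negbK -leqNgt iN' orbT.
have [mu mu0 Hmu] := nonzero_gap (coef (z + w)) N'.
(* The three bounds keep the new set inside the old one, make its diameter small, and keep later
   perturbations below the least nonzero coefficient [mu]. *)
pose d' := Num.min (d / 2) (Num.min (n.+1%:R^-1 / 2) (mu / (2 * D))).
have d'0 : 0 < d' by rewrite !lt_min d2 !divr_gt0 ?mulr_gt0 ?invr_gt0.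
have : d' <= d' by []. rewrite {2}/d' !le_min => /and3P[d'd d'n d'mu].
have z'gap i : coef (z + w) i != 0 -> D * d' < `|coef (z + w) i|.
  move=> zi; have iN' : (i < N')%N.
    by rewrite ltnNge; apply: contra zi => /z'N ->.
  apply: lt_le_trans (Hmu _ iN' zi).
  apply: (@le_lt_trans _ _ (mu / 2)); last by rewrite ltr_pdivrMr// ltr_pMr// ltr1n.
  by rewrite mulrC -ler_pdivlMr// -mulrA -invfM.
exists (z + w), N', d'; split=> //.
  move=> x [[Ex xz'] cx]; split; first split=> //.
    rewrite (_ : x - z = (x - (z + w)) + w); last by rewrite opprD addrA subrK.
    by rewrite (splitr d) (le_trans (ler_normD _ _))// lerD// (le_trans xz').
  move=> i iN; rewrite cx ?(leq_trans iN)// coef_z' w_out ?addr0//.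
  by rewrite negb_and -ltnNge iN.
(* At most [N] indices come from [z] and [m + 1] from the hump, and [gmax x (N + m)] reaches length
   [N + m + 1]. *)
move=> x [[Ex xz'] cx]; exists (N + m)%N.
have az i : (i < N)%N -> coef x i = coef z i.
  move=> iN; rewrite cx ?(leq_trans iN)// coef_z' w_out ?addr0//.
  by rewrite negb_and -ltnNge iN.
have aw i : (N <= i < N')%N -> coef x i = coef w i.
  by move=> /andP[Ni iN']; rewrite cx// coef_z' zN// add0r.
have zw i j : coef z i != 0 -> `|coef w j| < `|coef z i|.
  move=> /zgap; apply: le_lt_trans; apply: le_trans (HD _ Ew) _.
  by rewrite ler_pM2l// (le_trans wd)// ler_pdivrMr// ler_pMr// ler1n.
have gap i j : (i < N')%N -> coef x i != 0 -> (N' <= j)%N -> `|coef x j| < `|coef x i|.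
  move=> iN'; rewrite cx// => /z'gap h jN'; apply: le_lt_trans h.
  rewrite -[coef x j]subr0 -(z'N _ jN') -coefB//.
  apply: le_trans (HD _ _) _; first exact: cspanB.
  by rewrite ler_pM2l.
have zE : z = \sum_(i <- iota 0 N | coef z i != 0) coef z i *: e i.
  rewrite -{1}(psum_finite BS Ez zN) psumE [RHS]big_rmcond//.
  by move=> i; rewrite negbK => /eqP ->; rewrite scale0r.
have : gmax w m <=| gmax x (N + m) + labs z.
  apply: gmax_lub => // l lm; set W := greedy_indices e w l.
  have gW := greedy_indicesP SN BS l Ew.
  have gA := greedy_set_glue az aw wN zw gap NN' gW.
  have := greedy_sum_set SN BS Ex gA.
  set A := _ ++ _; have sA : (size A <= (N + m).+1)%N.
    rewrite size_cat -addnS leq_add// size_filter (leq_trans (count_size _ _))//.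
      by rewrite size_iota.
    by rewrite size_greedy_indices.
  rewrite big_cat /= !big_filter.
  rewrite (_ : \sum_(i <- iota 0 N | _) _ = z); last first.
    rewrite [RHS]zE [LHS]big_seq_cond [RHS]big_seq_cond; apply: eq_bigr => i.
    by rewrite mem_iota add0n => /andP[/andP[_ iN] _]; rewrite az.
  rewrite (_ : \sum_(i <- _ | _) _ = greedy_sum w l); last first.
    rewrite greedy_sumE -(big_rmcond (fun i => coef w i != 0)) /=; last first.
      by move=> i; rewrite negbK => /eqP ->; rewrite scale0r.
    by apply: eq_bigr => i wi; rewrite aw// wN.
  move=> gE; have -> : greedy_sum w l = greedy_sum x (size A) - z.
    by rewrite gE addrAC subrr add0r.
  apply: (lle_trans BL (labsB BL _ _)); apply: lleD => //; last exact: lle_refl.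
  exact: greedy_le_gmax.
move=> /(lle_norm_pos BL (gmax_ge0 _ BL _ _)) h.
rewrite -(ltrD2r `|z|); apply: (lt_le_trans Hm); apply: (le_trans h).
by rewrite -(norm_labs BL z) ler_normD.
Qed.

Lemma gmax_unbounded : exists2 x, E x & forall n : nat, exists M, n%:R < `|gmax x M|.
Proof.
pose FF := [set F | exists z N (d : R), hump_center z N d /\ F = hump_set z N d].
have [|||x [[Ex _] _] Hx] :=
  @nested_closed_sets R X FF (fun n => [set x | forall M, `|gmax x M| <= n%:R])
    (hump_set 0 0 1).
- move=> _ [z [N [d [[Ez d0 _ _] ->]]]]; split; first exact: closed_hump_set.
  by exists z; split=> //; split=> //; rewrite subrr normr0 ltW.
- move=> _ n [z [N [d [hz ->]]]].
  have [z' [N' [d' [hz' sub d'n H]]]] := hump_step n hz.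
  exists (hump_set z' N' d'); split=> //; first by exists z', N', d'.
    rewrite -subset0 => x [/H[M HM] /(_ M)].
    by rewrite leNgt HM.
  move=> x y [[_ hx] _] [[_ hy] _]; rewrite (le_trans (ler_distD z' _ _))//.
  rewrite (splitr n.+1%:R^-1) lerD//; first exact: le_trans hx d'n.
  by rewrite distrC; exact: le_trans hy d'n.
(* At the zero vector the gap condition is vacuous, so the construction can start there. *)
- exists 0, 0%N, 1; split=> //; split=> //; first exact: cspan0.
    by move=> i _; rewrite coef0.
  by move=> i; rewrite coef0// eqxx.
exists x => // n; have /existsNP[M /negP] := Hx n.
by rewrite -ltNge; exists M.
Qed.

End GlidingHump.

(** * The cycle of implications *)

Theorem theorem3p3 (R : realType) (X : completeNormedModType R)
    (jn : X -> X -> X) (e : nat -> X) :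
  is_banach_lattice jn -> seminormalized e -> basic_seq e ->
  [<-> (forall x, cspan e x -> u_cvg jn (greedy_sum e x) x);
       (forall x, cspan e x -> o_cvg jn (greedy_sum e x) x);
       (forall x, cspan e x -> exists u : X, forall m,
          lle jn (labs jn (greedy_sum e x m)) u);
       (forall x, cspan e x -> exists M : R, forall m,
          `|jsup jn (fun n => labs jn (greedy_sum e x n.+1)) m| <= M);
       (exists C : R, 1 <= C /\ forall x, cspan e x -> forall m,
          `|jsup jn (fun n => labs jn (greedy_sum e x n.+1)) m| <= C * `|x|)].
Proof.
move=> BL SN BS; tfae.
- by move=> H x Ex; apply: u_cvg_o_cvg => //; exact: H.
- move=> H x Ex; apply: (o_cvg_bounded BL _ (H x Ex)).
  by exists (e 0%N); case: BS.
- move=> H x Ex; have [u Hu] := H x Ex; exists `|u| => m.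
  by apply: (lle_norm_pos BL); [exact: gmax_ge0|exact: gmax_lub].
- move=> H; apply: contrapT => no.
  have [B B1 HB] := basis_constant SN BS.
  have [D D0 HD] := norm_coef_le SN B1 HB.
  have unbdd (C : R) : 1 <= C ->
      exists2 x, cspan e x & exists m, C * `|x| < `|gmax jn e x m|.
    move=> C1; apply: contrapT => no'; apply: no; exists C; split=> // x Ex m.
    by rewrite leNgt; apply/negP => h; apply: no'; exists x => //; exists m.
  have [x Ex Hx] := gmax_unbounded BL SN BS B1 HB unbdd D0 HD.
  have [M HM] := H x Ex.
  have [m] := Hx (Num.truncn M).+1; rewrite ltNge => /negP; apply.
  by apply: le_trans (HM m) _; rewrite ltW// truncnS_gt.
- by move=> [C [C1 HC]] x Ex; exact: greedy_sum_ucvg HC _ Ex.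
Qed.
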